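(* Let $A$ be a closed invariant subspace of $C(\mathbb{Z}^d)\otimes\mathbb{C}^r$. Then there is a finite set $\Omega\subset\mathbb{C}_*^d$ such that $A$ is the closed linear span of the vectorial $pg$-sequences in $A$ whose geometric indices lie in $\Omega$.
   Context: $C(\mathbb{Z}^d)\otimes\mathbb{C}^r=C(\mathbb{Z}^d;\mathbb{C}^r)$ is the space of all functions $u:\mathbb{Z}^d\to\mathbb{C}^r$ with the topology of coordinatewise (pointwise) convergence. For the standard generators $e_1,\dots,e_d$ of $\mathbb{Z}^d$, the shifts are $(W_iu)(k)=u(k-e_i)$; a subspace $A$ is invariant if $W_iA=A$ for each $i$. $\mathbb{C}_*^d=(\mathbb{C}\setminus\{0\})^d$. A vectorial $pg$-sequence with geometric index $\omega\in\mathbb{C}_*^d$ is a function $k\mapsto\omega^kh(k)$, where $\omega^k=\omega_1^{k_1}\cdots\omega_d^{k_d}$ and $h\in\mathbb{C}[z_1,\dots,z_d]\otimes\mathbb{C}^r$ is a vector of polynomials. *)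

(* Defs.v *)
From HB Require Import structures.
From mathcomp Require Import all_boot all_order all_algebra.
From mathcomp Require Import reals complex.
From mathcomp Require mpoly.
Set Implicit Arguments. Unset Strict Implicit. Unset Printing Implicit Defensive.
Import Order.TTheory GRing.Theory Num.Theory.
Local Open Scope ring_scope.

Section Defs.
Variables (R : realType) (d r : nat).

Local Notation C := (R[i]).

(* C(Z^d) (x) C^r : functions Z^d -> C^r; points of Z^d are row vectors of ints,
   a value in C^r is a function 'I_r -> C. *)
Definition vseq := 'rV[int]_d -> 'I_r -> C.

Definition gen (i : 'I_d) : 'rV[int]_d := delta_mx 0 i.

Definition shift (i : 'I_d) (u : vseq) : vseq := fun k => u (k - gen i).

Definition is_subspace (A : vseq -> Prop) : Prop :=
  [/\ A (fun _ _ => 0),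
      (forall u v, A u -> A v -> A (fun k j => u k j + v k j)) &
      (forall (a : C) u, A u -> A (fun k j => a * u k j))].

Definition is_invariant (A : vseq -> Prop) : Prop :=
  forall i : 'I_d,
    (forall u, A u -> A (shift i u)) /\
    (forall u, A u -> exists v, A v /\ shift i v = u).

(* closure for the topology of pointwise (coordinatewise) convergence, i.e.
   the product topology: every basic neighbourhood (finitely many points F,
   radius e) of u meets P. *)
Definition pw_closure (P : vseq -> Prop) (u : vseq) : Prop :=
  forall (F : seq 'rV[int]_d) (e : R), 0 < e ->
    exists v, P v /\ forall k, k \in F -> forall j, `|v k j - u k j| < e%:C%C.

Definition pw_closed (A : vseq -> Prop) : Prop :=
  forall u, pw_closure A u -> A u.

Definition lin_span (S : vseq -> Prop) (u : vseq) : Prop :=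
  exists (n : nat) (f : 'I_n -> vseq) (c : 'I_n -> C),
    (forall m, S (f m)) /\ u = fun k j => \sum_(m < n) c m * f m k j.

Definition closed_span (S : vseq -> Prop) : vseq -> Prop :=
  pw_closure (lin_span S).

Definition in_Cstar (w : 'rV[C]_d) : Prop := forall i, w 0 i != 0.

Definition gpow (w : 'rV[C]_d) (k : 'rV[int]_d) : C :=
  \prod_(i < d) (w 0 i) ^ (k 0 i).

Definition is_pg (w : 'rV[C]_d) (u : vseq) : Prop :=
  exists h : 'I_r -> mpoly.mpoly d C,
    forall k j, u k j = gpow w k * mpoly.meval (fun i => (k 0 i)%:~R) (h j).

End Defs.

(* Main.v *)
(* Let [M] be the module of finitely supported functionals on [vseq], over the
   ring of Laurent polynomials, and [N] the annihilator of [A]. As [A] is closed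
   it is determined by [N], so it suffices to find finitely many points [w] such
   that each [x] outside [N] is outside a submodule [L] containing [N] and
   [m_w ^ K M], where [m_w] is the maximal ideal of [w]: the functionals killing
   [L] are pg-sequences of [A] with index [w].

   By Noetherian induction one may assume [N] meet-irreducible. Then the zero
   divisors of [M / N] form a proper ideal, which vanishes at some point [w] by
   the Nullstellensatz. If [x] is not in [N] then [x] is not in [N + m_w x], for
   otherwise some [1 - a] with [a] in [m_w] would be a zero divisor. A submodule
   [L] maximal among those containing [N + m_w x] but not [x] contains
   [m_w ^ K M] for large [K], by Fitting's argument. *)
Require Import Defs.
From HB Require Import structures.
From mathcomp Require Import all_boot all_order all_algebra.
From mathcomp Require Import reals complex.
From mathcomp Require Import boolp classical_sets cardinality mpoly.
From mathcomp Require Import ring.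
From mathcomp Require lebesgue_measure.
Set Implicit Arguments.
Unset Strict Implicit.
Unset Printing Implicit Defensive.
Import Order.TTheory GRing.Theory Num.Theory.
Local Open Scope classical_set_scope.
Local Open Scope ring_scope.

(** * Ascending chain condition *)

Lemma subrBB (V : zmodType) (x y z w : V) : (x - y) - (z - w) = (x - z) - (y - w).
Proof. by rewrite !opprD !opprK addrACA. Qed.

Section OperatorSubgroups.
Variable V : zmodType.
Implicit Types (O : set (V -> V)) (D N : set V).

(** Operators in place of a ring of scalars: the variables can be adjoined one at a time to a fixed
    group, without changing the ring. *)
Definition opsub O N :=
  [/\ N 0, forall x y, N x -> N y -> N (x - y)
    & forall o x, O o -> N x -> N (o x)].

Definition acc O D := forall N : nat -> set V,
  (forall i, opsub O (N i)) -> (forall i, N i `<=` D) ->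
  (forall i, N i `<=` N i.+1) -> exists I, forall i, N i `<=` N I.

Lemma opsubN O N x : opsub O N -> N x -> N (- x).
Proof. by case=> N0 NB _ Nx; rewrite -sub0r; apply: NB. Qed.

Lemma opsubD O N x y : opsub O N -> N x -> N y -> N (x + y).
Proof.
by move=> ON Nx Ny; rewrite -[y]opprK; case: (ON) => _ + _; apply=> //;
  apply: opsubN ON Ny.
Qed.

Lemma chain_homo (N : nat -> set V) : (forall i, N i `<=` N i.+1) ->
  forall i j, (i <= j)%N -> N i `<=` N j.
Proof.
move=> NS i j /subnK <-; elim: (j - i)%N => [//|k IH] x /IH Nx.
by rewrite addSn; apply: NS.
Qed.

Lemma opsubI O D N : opsub O D -> opsub O N -> opsub O (N `&` D).
Proof.
case=> D0 DB Do [N0 NB No]; split=> // [x y [? ?] [? ?]|o x Oo [? ?]].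
  by split; [apply: NB | apply: DB].
by split; [apply: No | apply: Do].
Qed.

Section Adjoin.
Variables (O : set (V -> V)) (D : set V) (t : V -> V).
Hypothesis OB : forall o, O o -> {morph o : x y / x - y}.
Hypothesis Ot : forall o x, O o -> o (t x) = t (o x).
Hypothesis tB : {morph t : x y / x - y}.
Hypothesis OD : opsub O D.

(** The sum of [D], [t D], ..., [t^(k-1) D], which plays the role of the polynomials in [t] of
    degree below [k]; the sum need not be direct. *)
Fixpoint low k : set V :=
  if k is k'.+1 then
    [set x | exists2 y, low k' y & exists2 a, D a & x = y + iter k' t a]
  else [set 0].

Definition powspan : set V := [set x | exists k, low k x].

Let morph0 (f : V -> V) : {morph f : x y / x - y} -> f 0 = 0.
Proof. by move=> fB; rewrite -[X in f X](subrr 0) fB subrr. Qed.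

Let morphD (f : V -> V) : {morph f : x y / x - y} -> {morph f : x y / x + y}.
Proof.
move=> fB x y; rewrite -{1}[y]opprK fB; congr (_ + _).
by rewrite -[X in f X]sub0r fB morph0 // sub0r opprK.
Qed.

Let iterB k : {morph iter k t : x y / x - y}.
Proof. by elim: k => [|k IH] x y //=; rewrite IH tB. Qed.

Let iterO k o x : O o -> o (iter k t x) = iter k t (o x).
Proof. by move=> Oo; elim: k => [|k IH] //=; rewrite Ot // IH. Qed.

Lemma opsub_low k : opsub O (low k).
Proof.
case: (OD) => D0 DB Do; elim: k => [|k [L0 LB Lo]].
  split=> //= [x y -> ->|o x Oo ->]; first by rewrite subr0.
  by rewrite morph0 //; apply: OB.
split=> /=.
- by exists 0 => //; exists 0; rewrite // add0r (morph0 (iterB k)).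
- move=> _ _ [x Lx [a Da ->]] [y Ly [b Db ->]].
  exists (x - y); first exact: LB.
  by exists (a - b); [apply: DB | rewrite iterB opprD addrACA].
- move=> o _ Oo [x Lx [a Da ->]]; exists (o x); first exact: Lo.
  exists (o a); first exact: Do.
  by rewrite -iterO // morphD //; apply: OB.
Qed.

Lemma low_shift k x : low k x -> low k.+1 (t x).
Proof.
elim: k x => [|k IH] x.
  move=> ->; case: (OD) => D0 _ _; exists 0 => //; exists 0 => //.
  by rewrite (morph0 tB) addr0.
move=> /= [y Ly [a Da ->]]; exists (t y); first exact: IH.
by exists a; rewrite // morphD.
Qed.

Lemma low_homo : forall i j, (i <= j)%N -> low i `<=` low j.
Proof.
apply: chain_homo => k x Lx; exists x => //; exists 0; first by case: OD.
by rewrite (morph0 (iterB k)) addr0.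
Qed.

Lemma sub_powspan : D `<=` powspan.
Proof.
by move=> x Dx; exists 1%N; exists 0 => //; exists x; rewrite // add0r.
Qed.

Lemma opsub_powspan : opsub (O `|` [set t]) powspan.
Proof.
split; first by exists 0%N.
- move=> x y [k Lx] [l Ly]; exists (maxn k l).
  by case: (opsub_low (maxn k l)) => _ + _; apply;
    [apply: low_homo Lx; rewrite leq_maxl | apply: low_homo Ly; rewrite leq_maxr].
- move=> o x [Oo|->] [k Lx]; last by exists k.+1; apply: low_shift.
  by exists k; case: (opsub_low k) => _ _; apply.
Qed.

(** The analogue of the ideal of leading coefficients in degree [k]. As [low] is not a direct sum,
    one [b] may have several leading coefficients. *)
Definition lead N k : set V :=
  [set a | D a /\ exists2 b, N b & low k (b - iter k t a)].

Lemma opsub_lead N k : opsub O N -> opsub O (lead N k).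
Proof.
case: (OD) => D0 DB Do [N0 NB No]; case: (opsub_low k) => L0 LB Lo; split.
- by split=> //; exists 0; rewrite // (morph0 (iterB k)) subrr.
- move=> a b [Da [x Nx Lx]] [Db [y Ny Ly]]; split; first exact: DB.
  exists (x - y); first exact: NB.
  by rewrite iterB subrBB; apply: LB.
- move=> o a Oo [Da [x Nx Lx]]; split; first exact: Do.
  by exists (o x); [apply: No | rewrite -iterO // -(OB Oo); apply: Lo].
Qed.

Lemma lead_sub N1 N2 k : N1 `<=` N2 -> lead N1 k `<=` lead N2 k.
Proof. by move=> sN a [Da [x /sN Nx Lx]]; split=> //; exists x. Qed.

Lemma leadS N k : opsub (O `|` [set t]) N -> lead N k `<=` lead N k.+1.
Proof.
case=> _ _ No a [Da [x Nx Lx]]; split=> //.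
exists (t x); first by apply: No => //; right.
by rewrite /= -tB; apply: low_shift.
Qed.

(** By induction on the degree: subtracting from [x] an element of [N1] with the same leading
    coefficient leaves an element of [N2] of lower degree. *)
Lemma lead_inj N1 N2 : opsub (O `|` [set t]) N1 -> opsub (O `|` [set t]) N2 ->
  N1 `<=` N2 -> N2 `<=` powspan -> (forall k, lead N2 k `<=` lead N1 k) ->
  N2 `<=` N1.
Proof.
move=> ON1 ON2 s12 sN2 sl x N2x; have [k] := sN2 _ N2x.
elim: k x N2x => [|k IH] x N2x; first by move=> ->; case: ON1.
move=> /= [y Ly [a Da xE]].
have [|_ [b N1b Lb]] := sl k a.
  by split=> //; exists x; rewrite // xE addrK.
rewrite -(subrK b x); apply: (opsubD ON1 _ N1b); apply: IH.
  by have [_ N2B _] := ON2; exact: N2B N2x (s12 _ N1b).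
rewrite xE -addrA -opprB.
by case: (opsub_low k) => _ + _; apply.
Qed.

(* Hilbert's basis theorem: a chain is controlled by the double chain of its
   leading coefficient groups, which stabilises along the diagonal and on each
   of the finitely many remaining columns. *)
Lemma acc_powspan : acc O D -> acc (O `|` [set t]) powspan.
Proof.
move=> aD N ON sN NS.
have ON' i : opsub O (N i).
  by case: (ON i) => ? ? No; split=> // o x Oo; apply: No; left.
have lN i j k l : (i <= j)%N -> (k <= l)%N ->
    lead (N i) k `<=` lead (N j) l.
  move=> ij kl; apply: subset_trans (lead_sub _) (_ : lead (N j) k `<=` _).
    exact: chain_homo.
  by apply: (chain_homo (N := lead (N j))) => // k'; apply: leadS.
have [I0 hI0] : exists I, forall i, lead (N i) i `<=` lead (N I) I.
  apply: (aD (fun i => lead (N i) i)) => i.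
  - exact: opsub_lead.
  - by move=> x [].
  - exact: lN.
have [J hJ] : exists J, forall k i, (k < I0)%N -> lead (N i) k `<=` lead (N J) k.
  elim: I0 {hI0} => [|K [J hJ]]; first by exists 0%N.
  have [J' hJ'] : exists I, forall i, lead (N i) K `<=` lead (N I) K.
    apply: (aD (fun i => lead (N i) K)) => i.
    - exact: opsub_lead.
    - by move=> x [].
    - exact: lN.
  exists (maxn J J') => k i; rewrite ltnS leq_eqVlt => /orP[/eqP->|kK].
    by apply: subset_trans (hJ' i) _; apply: lN; rewrite ?leq_maxr.
  by apply: subset_trans (hJ k i kK) _; apply: lN; rewrite ?leq_maxl.
exists (maxn I0 J) => i.
(* [lead_inj] compares nested groups, so [N i] is first enlarged to an index above [maxn I0 J]. *)
apply: (@subset_trans _ (N (maxn i (maxn I0 J)))).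
  by apply: chain_homo; rewrite ?leq_maxl.
apply: lead_inj => // [|k]; first by apply: chain_homo; rewrite ?leq_maxr.
move: (maxn i _) => {}i.
have [kI|Ik] := ltnP k I0.
  by apply: subset_trans (hJ k i kI) _; apply: lN; rewrite ?leq_maxr.
apply: (@subset_trans _ (lead (N (maxn i k)) (maxn i k))).
  by apply: lN; rewrite ?leq_maxl ?leq_maxr.
by apply: subset_trans (hI0 _) _; apply: lN; rewrite ?leq_maxl.
Qed.

End Adjoin.
End OperatorSubgroups.

(** * Chain condition for finitely generated modules over finitely generated algebras *)

Section FinitelyGenerated.
Variables (F : fieldType) (T : comNzRingType) (iota : {rmorphism F -> T}).
Variable M : lmodType T.
Implicit Types (N : set M) (ts : seq T) (gs : seq M).

Definition submod N :=
  [/\ N 0, forall x y, N x -> N y -> N (x + y) & forall a x, N x -> N (a *: x)].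

Definition noetherian := forall N : nat -> set M,
  (forall i, submod (N i)) -> (forall i, N i `<=` N i.+1) ->
  exists I, forall i, N i `<=` N I.

Definition scalings ts : set (M -> M) :=
  [set o | exists2 t, (exists c, t = iota c) \/ t \in ts & o = *:%R t].

Fixpoint linspan gs : set M :=
  if gs is g :: gs' then
    [set x | exists c, linspan gs' (x - iota c *: g)] else [set 0].

Lemma opsub_linspan gs : opsub (scalings [::]) (linspan gs).
Proof.
elim: gs => [|g gs [L0 LB Lo]] /=.
  split=> //= [x y -> ->|_ x [t _ ->] ->]; first by rewrite subr0.
  by rewrite scaler0.
split=> /=.
- by exists 0; rewrite rmorph0 scale0r subr0.
- move=> x y [c Lx] [e Ly]; exists (c - e).
  by rewrite rmorphB scalerBl subrBB; apply: LB.
- move=> _ x [_ [[e ->]|//] ->] [c Lx]; exists (e * c).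
  rewrite rmorphM -scalerA -scalerBr.
  by apply: (Lo ( *:%R (iota e))) => //; exists (iota e) => //; left; exists e.
Qed.

(** Induction on [gs]. Either every element of the chain has coefficient 0 at [g], and the chain
    lies in the span of the tail; or some [b] has a nonzero one, and subtracting multiples of [b]
    moves later elements into that span. *)
Lemma acc_linspan gs : acc (scalings [::]) (linspan gs).
Proof.
elim: gs => [|g gs IH] N ON sN NS.
  exists 0%N => i x /sN ->; by case: (ON 0%N).
have [I0 hI0] : exists I, forall i,
    (N i `&` linspan gs) `<=` (N I `&` linspan gs).
  apply: (IH (fun i => N i `&` linspan gs)) => i.
  - by apply: opsubI => //; apply: opsub_linspan.
  - by move=> x [].
  - by move=> x [/NS].
have [[i [b [c [c0 Nb Lb]]]]|nex] := pselect (exists i b c,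
    [/\ c != 0, N i b & linspan gs (b - iota c *: g)]); last first.
  exists I0 => i x Nx; have /= [c Lx] := sN _ _ Nx.
  have [c0|c0] := eqVneq c 0; last by case: nex; exists i, x, c.
  rewrite c0 rmorph0 scale0r subr0 in Lx.
  by case: (hI0 i x).
exists (maxn I0 i) => j x Nx; have /= [e Lx] := sN _ _ Nx.
have sc a k y : N k y -> N k (iota a *: y).
  move=> Ny; case: (ON k) => _ _ /(_ ( *:%R (iota a))); apply=> //.
  by exists (iota a) => //; left; exists a.
have hm k l : (k <= l)%N -> N k `<=` N l by exact: chain_homo.
have [y yE] : exists y, y = x - iota (e / c) *: b by exists (x - iota (e / c) *: b).
have Ly : linspan gs y.
  have -> : y = (x - iota e *: g) - iota (e / c) *: (b - iota c *: g).
    by rewrite yE scalerBr scalerA -rmorphM divfK // subrBB subrr subr0.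
  case: (opsub_linspan gs) => _ LB Lo; apply: LB => //.
  apply: (Lo ( *:%R (iota (e / c)))) => //.
  by exists (iota (e / c)) => //; left; exists (e / c).
have Ny : N (maxn j i) y.
  rewrite yE; case: (ON (maxn j i)) => _ + _; apply.
    by apply: hm Nx; rewrite leq_maxl.
  by apply: sc; apply: hm Nb; rewrite leq_maxr.
have [NIy _] := hI0 (maxn j i) y (conj Ny Ly).
rewrite -(subrK (iota (e / c) *: b) x) -yE.
apply: opsubD (ON _) _ _; first by apply: hm NIy; rewrite leq_maxl.
by apply: sc; apply: hm Nb; rewrite leq_maxr.
Qed.

(** Starting from the linear span of [gs], each element of [ts] is adjoined by one use of
    [acc_powspan]. *)
Lemma acc_scalings ts gs : exists D,
  [/\ linspan gs `<=` D, opsub (scalings ts) D & acc (scalings ts) D].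
Proof.
elim: ts => [|t ts [D [sD OD aD]]].
  by exists (linspan gs); split; [|apply: opsub_linspan|apply: acc_linspan].
have OB o : scalings ts o -> {morph o : x y / x - y}.
  by move=> [s _ ->] x y; rewrite scalerBr.
have Ot o x : scalings ts o -> o (t *: x) = t *: o x.
  by move=> [s _ ->]; rewrite !scalerA mulrC.
have tB : {morph *:%R t : x y / x - y :> M} by move=> x y; rewrite scalerBr.
have Oe : scalings (t :: ts) = scalings ts `|` [set *:%R t].
  apply/seteqP; split=> [_ [s hs ->]|_ [[s hs ->]|->]].
  - rewrite inE in hs; case: hs => [hs|/orP[/eqP->|hs]]; last 2 first.
    + by right.
    + by left; exists s => //; right.
    by left; exists s => //; left.
  - by exists s => //; rewrite inE; case: hs => [|->]; [left|rewrite orbT; right].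
  - by exists t => //; rewrite inE eqxx; right.
exists (powspan D ( *:%R t)); rewrite Oe; split.
- by apply: subset_trans sD _; apply: sub_powspan.
- exact: opsub_powspan.
- exact: acc_powspan.
Qed.

Lemma mem_linspan gs g : g \in gs -> linspan gs g.
Proof.
elim: gs => [//|h gs IH]; rewrite inE => /orP[/eqP->|/IH Lg] /=.
  by exists 1; rewrite rmorph1 scale1r subrr; case: (opsub_linspan gs).
by exists 0; rewrite rmorph0 scale0r subr0.
Qed.

Lemma submod_opsub ts N : submod N -> opsub (scalings ts) N.
Proof.
case=> N0 ND NZ; split=> // [x y Nx Ny|_ x [t _ ->]]; last exact: NZ.
by apply: ND => //; rewrite -scaleN1r; apply: NZ.
Qed.

(** The hypothesis says that [gs] generates [M] under [ts] and the constants; it makes the group [D]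
    of [acc_scalings] all of [M]. *)
Lemma fg_noetherian ts gs :
  (forall L, opsub (scalings ts) L -> (forall g, g \in gs -> L g) ->
     forall x, L x) -> noetherian.
Proof.
move=> fg N sN NS; have [D [sD OD aD]] := acc_scalings ts gs.
apply: (aD N) => // [i|i x _]; first exact: submod_opsub.
by apply: fg => // g /mem_linspan/sD.
Qed.

End FinitelyGenerated.

Section NoetherianModules.
Variables (T : comNzRingType) (M : lmodType T).
Implicit Types N L : set M.

Lemma submodB N x y : submod N -> N x -> N y -> N (x - y).
Proof. by case=> _ ND NZ Nx Ny; apply: ND; rewrite // -scaleN1r; apply: NZ. Qed.

Lemma noetherian_max (P : set (set M)) N0 : noetherian M ->
  (forall N, P N -> submod N) -> P N0 ->
  exists N, [/\ P N, N0 `<=` N & forall N', P N' -> N `<=` N' -> N' `<=` N].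
Proof.
move=> nM sP PN0; apply: contrapT => nmax.
(* The condition is put inside the existential so that [choice] gives a total function, whose
   iterates from [N0] form a strictly ascending chain. *)
have step N : exists N', P N /\ N0 `<=` N -> [/\ P N', N `<=` N' & ~ (N' `<=` N)].
  have [[PN sN]|nP] := pselect (P N /\ N0 `<=` N); last by exists N.
  apply: contrapT => nex; apply: nmax; exists N; split=> // N' PN' NN'.
  by apply: contrapT => nNN'; apply: nex; exists N'.
have [f fP] := choice step.
pose C i := iter i f N0.
have CP i : P (C i) /\ N0 `<=` C i.
  elim: i => [|i [PC sC]]; first by split.
  have [PC' CC' _] := fP _ (conj PC sC).
  by split=> //; apply: subset_trans sC CC'.
have CS i : C i `<=` C i.+1 by have [] := fP _ (CP i).
have [I hI] := nM C (fun i => sP _ (proj1 (CP i))) CS.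
by have [_ _ []] := fP _ (CP I); apply: hI I.+1.
Qed.

End NoetherianModules.

Section PolynomialModules.
Variables (F : fieldType) (n : nat).
Local Notation T := {mpoly F[n]}.

Lemma mpoly_subring_ind (Q : T -> Prop) :
  (forall c, Q c%:MP) -> (forall i, Q 'X_i) ->
  (forall p q, Q p -> Q q -> Q (p + q)) ->
  (forall p q, Q p -> Q q -> Q (p * q)) -> forall p, Q p.
Proof.
move=> QC QX QD QM; elim/mpolyind => [|c m p _ _ Qp]; first by rewrite -mpolyC0.
apply: QD => //; rewrite -mul_mpolyC; apply: (QM) => //.
rewrite mpolyXE_id; apply: (big_ind Q) => //; first by rewrite -mpolyC1.
move=> i _; elim: (m i) => [|k IH]; first by rewrite expr0 -mpolyC1.
by rewrite exprS; apply: QM.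
Qed.

Lemma submod_mpoly (M : lmodType T) (N : set M) : N 0 ->
  (forall x y, N x -> N y -> N (x + y)) ->
  (forall c x, N x -> N (c%:MP *: x)) -> (forall i x, N x -> N ('X_i *: x)) ->
  submod N.
Proof.
move=> N0 ND NC NX; split=> //.
elim/mpoly_subring_ind => [c|i|p q Np Nq|p q Np Nq] x Nx.
- exact: NC.
- exact: NX.
- by rewrite scalerDl; apply: ND; [apply: Np|apply: Nq].
- by rewrite -scalerA; apply: Np; apply: Nq.
Qed.

Lemma opsub_mpoly (M : lmodType T) (L : set M) :
  opsub (scalings (@mpolyC n F) [seq 'X_i | i <- enum 'I_n]) L -> submod L.
Proof.
move=> OL; case: (OL) => L0 LB Lo; apply: submod_mpoly => //.
- by move=> x y; apply: (opsubD OL).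
- by move=> c x; apply: (Lo ( *:%R c%:MP)); exists c%:MP => //; left; exists c.
- move=> i x; apply: (Lo ( *:%R 'X_i)); exists 'X_i => //; right.
  by apply: map_f; rewrite mem_enum.
Qed.

Lemma noetherian_mpoly : noetherian T^o.
Proof.
apply: (@fg_noetherian _ _ (@mpolyC n F) T^o [seq 'X_i | i <- enum 'I_n] [:: 1]).
move=> L /opsub_mpoly[_ _ LZ] gL x; rewrite -[x]mulr1; apply: LZ.
by apply: gL; rewrite inE.
Qed.

Lemma noetherian_rV r : noetherian 'rV[T]_r.
Proof.
apply: (@fg_noetherian _ _ (@mpolyC n F) 'rV[T]_r [seq 'X_i | i <- enum 'I_n]
   [seq delta_mx 0 j | j <- enum 'I_r]).
move=> L /opsub_mpoly[L0 LD LZ] gL x; rewrite [x]row_sum_delta.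
apply: (big_ind L) => // j _; apply: LZ; apply: gL.
by apply: map_f; rewrite mem_enum.
Qed.

End PolynomialModules.

(** * Nullstellensatz *)

(** Otherwise [R] is a countable union of finite sets, and the unit interval has Lebesgue measure 0
    instead of 1. *)
Lemma infinite_fiber (R : realType) (f : R -> nat) :
  exists N, infinite_set [set x | f x = N].
Proof.
apply: contrapT => nex.
have cR : countable [set: R].
  have -> : [set: R] = \bigcup_(N in [set: nat]) [set x | f x = N].
    by apply/seteqP; split=> // x _; exists (f x).
  apply: bigcup_countable => // N _; apply: finite_set_countable.
  by apply: contrapT => infN; apply: nex; exists N.
have := lebesgue_measure.countable_lebesgue_measure0
  (sub_countable (subset_card_le (@subsetT _ `[0, 1])) cR).
rewrite lebesgue_measure.lebesgue_measure_itv /= constructive_ereal.lte_fin ltr01.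
move=> /(congr1 (@constructive_ereal.fine R)) /=.
by rewrite subr0 => /eqP; rewrite oner_eq0.
Qed.

Section MaximalIdeals.
Variables (T : comNzRingType) (m : set T^o).
Hypothesis (sm : submod m) (m1 : ~ m 1).
Hypothesis maxm : forall m' : set T^o,
  submod m' -> ~ m' 1 -> m `<=` m' -> m' `<=` m.

(** If [a] has no inverse modulo [m], the ideal [m + a T] is proper, so by maximality it lies in [m]
    and [a] is in [m]. *)
Lemma maximal_ideal_inv a : ~ m a -> exists g, m (a * g - 1).
Proof.
move=> ma; case: (sm) => m_0 mD mZ; apply: contrapT => ninv; apply: ma.
pose m' : set T^o := [set y | exists b, m (y - a * b)].
apply: (maxm (m' := m')).
- split=> [|x y [b mx] [c my]|e x [b mx]].
  + by exists 0; rewrite mulr0 subr0.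
  + by exists (b + c); rewrite mulrDr opprD addrACA; apply: mD.
  + by exists (e * b); rewrite mulrCA -mulrBr; apply: mZ.
- move=> [b mb]; apply: ninv; exists b.
  by rewrite -opprB -mulN1r; apply: mZ.
- by move=> x mx; exists 0; rewrite mulr0 subr0.
- by exists 1; rewrite mulr1 subrr.
Qed.

Lemma maximal_ideal_prime a b : m (a * b) -> m a \/ m b.
Proof.
move=> mab; have [|/maximal_ideal_inv[g mg]] := pselect (m a); first by left.
right; case: (sm) => _ mD mZ.
have -> : b = g * (a * b) + - b * (a * g - 1).
  by ring.
by apply: mD; apply: mZ.
Qed.

Lemma maximal_ideal_prod (I : eqType) (s : seq I) (F : I -> T) :
  m (\prod_(i <- s) F i) -> exists2 i, i \in s & m (F i).
Proof.
elim: s => [|i s IH]; first by rewrite big_nil => /m1.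
rewrite big_cons => /maximal_ideal_prime[mi|/IH[j js mj]].
  by exists i; rewrite ?mem_head.
by exists j; rewrite // inE js orbT.
Qed.

End MaximalIdeals.

Section Nullstellensatz.
Variables (R : realType) (n : nat).
Local Notation C := R[i].
Local Notation T := {mpoly C[n]}.

(** [msize] exceeds the degree by one, so the [g l] only involve monomials of degree below [N];
    there are more polynomials than such monomials, so the rows of the coefficient matrix are
    dependent. *)
Lemma bounded_mpoly_dep N (I : finType) (g : I -> T) :
  (#|{: 'X_{1..n < N}}| < #|I|)%N -> (forall l, (msize (g l) <= N)%N) ->
  exists2 c : I -> C, (exists l, c l != 0) & \sum_l c l *: g l = 0.
Proof.
move=> cI gN.
pose A : 'M[C]_(#|I|, #|{: 'X_{1..n < N}}|) :=
  \matrix_(l, k) (g (enum_val l))@_(val (enum_val k : 'X_{1..n < N})).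
have /rowV0Pn[v /sub_kermxP vA v0] : kermx A != 0.
  rewrite kermx_eq0 /row_free; apply/eqP => rA.
  by have := rank_leq_col A; rewrite rA leqNgt cI.
exists (fun l => v 0 (enum_rank l)).
  have /rV0Pn[l vl] : v != 0 by [].
  by exists (enum_val l); rewrite enum_valK.
apply/mpolyP => k; rewrite raddf_sum mcoeff0 /=.
have [kN|Nk] := ltnP (mdeg k) N; last first.
  apply: big1 => l _; rewrite mcoeffZ; apply/eqP; rewrite mulf_eq0.
  by rewrite mcoeff_eq0 msize_mdeg_ge ?orbT //; apply: leq_trans (gN l) Nk.
have /rowP/(_ (enum_rank (BMultinom kN))) := vA.
rewrite !mxE => vAk; rewrite -[RHS]vAk [RHS](reindex (@enum_rank I)) /=; last first.
  by apply: onW_bij; apply: enum_rank_bij.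
by apply: eq_bigr => l _; rewrite mcoeffZ !mxE !enum_rankK.
Qed.

(* The inverses of the uncountably many [X_i - c] lie in a space of countable
   dimension, so some linear relation between them holds; clearing
   denominators gives a nonzero polynomial in [X_i] alone. *)
Lemma maximal_ideal_point (m : set T^o) : submod m -> ~ m 1 ->
  (forall m' : set T^o, submod m' -> ~ m' 1 -> m `<=` m' -> m' `<=` m) ->
  forall i, exists c, m ('X_i - c%:MP).
Proof.
move=> sm m1 maxm i; apply: contrapT => nc.
have inv (x : R) : exists g, m (('X_i - (x%:C)%C%:MP) * g - 1).
  by apply: (maximal_ideal_inv sm maxm) => mx; apply: nc; exists (x%:C)%C.
have [g gP] := choice inv.
(* Infinitely many inverses share one size [N]; taking more of them than there are monomials of
   degree below [N] forces a linear relation. *)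
have [N infN] := infinite_fiber (fun x => msize (g x)).
have [B sB cB] := infinite_set_fset (#|{: 'X_{1..n < N}}|.+1) infN.
pose I : finType := seq_sub (finmap.enum_fset B).
have [||c [l0 cl0] cg] := @bounded_mpoly_dep N I (fun l => g (val l)).
- by rewrite card_seq_sub // finmap.fset_uniq.
- by move=> l; rewrite (sB (val l)) //=; apply: ssvalP.
pose z (l : I) : C := ((val l)%:C)%C.
have zI : injective z.
  by move=> a b /eqP; rewrite eq_complex /= eqxx andbT => /eqP /val_inj.
pose Q l := \prod_(k | k != l) ('X - (z k)%:P) : {poly C}.
pose q := \sum_l c l *: Q l.
(* At [z l0] every [Q l] with [l != l0] vanishes and [Q l0] does not, the [z k] being distinct. *)
have q0 : q != 0.
  apply: contra_neq cl0 => /(congr1 (horner^~ (z l0))).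
  rewrite horner0 horner_sum (bigD1 l0) //= big1 => [|k kl]; last first.
    rewrite hornerZ horner_prod (bigD1 l0) 1?eq_sym //= hornerXsubC subrr.
    by rewrite mul0r mulr0.
  rewrite addr0 hornerZ => /eqP; rewrite mulf_eq0 => /orP[/eqP//|].
  rewrite horner_prod; move=> /prodf_eq0[k kl].
  by rewrite hornerXsubC subr_eq0 (inj_eq zI) eq_sym (negPf kl).
pose Phi := GRing.RMorphism.clone _ _ (horner_alg ('X_i : T)) _.
have PhiX a : Phi ('X - a%:P) = 'X_i - a%:MP.
  by rewrite rmorphB /= horner_algX horner_algC alg_mpolyC.
have PhiZ a p : Phi (a *: p) = a%:MP * Phi p.
  by rewrite -mul_polyC rmorphM /= horner_algC alg_mpolyC.
have mq : m (Phi q).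
  case: (sm) => m_0 mD mZ.
  (* The product of [Q l] with its missing factor is the same for all [l], so the subtracted terms
     add up to a multiple of the relation [cg]; each remaining bracket lies in [m]. *)
  have -> : Phi q = \sum_l (c l)%:MP * (Phi (Q l) * (1 - ('X_i - (z l)%:MP) * g (val l))).
    under eq_bigr => l _.
      rewrite mulrBr mulr1 mulrA -PhiX -rmorphM /= mulrBr.
      rewrite (_ : Q l * ('X - (z l)%:P) = \prod_k ('X - (z k)%:P)); last first.
        by rewrite [RHS](bigD1 l) //= mulrC.
      rewrite [X in _ - X]mulrCA [X in _ - _ * X]mul_mpolyC.
      over.
    rewrite sumrB -mulr_sumr cg mulr0 subr0 /q rmorph_sum.
    by apply: eq_bigr => l _; rewrite PhiZ.
  apply: (big_ind m) => // l _; do 2 apply: (mZ).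
  by rewrite -opprB -mulN1r; apply: mZ; apply: gP.
(* Over the complex numbers [q] splits into linear factors, and the prime ideal [m] contains the
   image of one of them. *)
have [r qE] := closed_field_poly_normal q.
move: mq; rewrite qE PhiZ rmorph_prod.
case/(maximal_ideal_prime sm maxm) => [mc|].
  case: (sm) => _ _ /(_ (lead_coef q)^-1%:MP _ mc).
  by rewrite /GRing.scale /= -mpolyCM mulVf ?lead_coef_eq0 // mpolyC1 => /m1.
move=> /(maximal_ideal_prod sm m1 maxm)[a _]; rewrite PhiX => ma.
by apply: nc; exists a.
Qed.

(** Extend [p] to a maximal ideal [m]. Modulo [m] each variable is a constant [w i], so each
    polynomial is congruent to its value at [w]; a nonzero value of some [f] in [p] would put a unit
    in [m]. *)
Lemma weak_nullstellensatz (p : set T^o) : submod p -> ~ p 1 ->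
  exists w : 'rV[C]_n, forall f, p f -> meval (w 0) f = 0.
Proof.
move=> sp p1.
have [|m [[sm m1] pm maxm]] := noetherian_max (P := [set m : set T^o | submod m /\ ~ m 1])
  (@noetherian_mpoly C n) _ (conj sp p1); first by move=> N [].
have {}maxm (m' : set T^o) : submod m' -> ~ m' 1 -> m `<=` m' -> m' `<=` m.
  by move=> *; apply: maxm.
have [w wP] := choice (maximal_ideal_point sm m1 maxm).
exists (\row_i w i) => f pf; apply/eqP; apply: contrapT => f0; apply: m1.
case: (sm) => _ mD mZ.
have mf h : m (h - (meval ((\row_i w i) 0) h)%:MP).
  elim/mpoly_subring_ind: h => [c|i|h k mh mk|h k mh mk].
  - by rewrite mevalC subrr; case: sm.
  - by rewrite mevalXU mxE.
  - by rewrite mevalD mpolyCD opprD addrACA; apply: mD.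
  - rewrite mevalM mpolyCM -(subrK (h * (meval ((\row_i w i) 0) k)%:MP) (h * k)).
    rewrite -addrA -mulrBr -mulrBl [X in _ + X]mulrC.
    by apply: mD; apply: mZ.
have [e eE] : exists e, e = meval ((\row_i w i) 0) f by eexists.
rewrite -eE in f0; have := mf f; rewrite -eE => mfe.
have me : m e%:MP.
  have -> : e%:MP = f + -1 * (f - e%:MP) by rewrite mulN1r opprB addrC subrK.
  by apply: mD; [apply: pm|apply: mZ].
have := mZ (e^-1)%:MP _ me.
by rewrite /GRing.scale /= -mpolyCM mulVf ?mpolyC1 //; apply/negP.
Qed.

End Nullstellensatz.

(** * Separation of submodules at finitely many points *)

Section FiniteLocalization.
Variables (R : realType) (n : nat).
Local Notation C := R[i].
Local Notation T := {mpoly C[n]}.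
Variable M : lmodType T.
Hypothesis noethM : noetherian M.
Implicit Types (N L : set M) (Om : seq 'rV[C]_n).

(* Fitting's argument: [L] being maximal among the submodules avoiding [x],
   it contains [f ^+ k *: M] as soon as the kernels of the powers of [f] on
   [M / L] are stationary from [k] on. *)
Lemma maximal_avoiding_nilpotent L x (f : T) : submod L -> ~ L x ->
  (forall L', submod L' -> ~ L' x -> L `<=` L' -> L' `<=` L) ->
  L (f *: x) -> exists k, forall y, L (f ^+ k *: y).
Proof.
move=> sL Lx maxL Lfx; case: (sL) => L0 LD LZ.
have [k hk] : exists k, forall i y, L (f ^+ i *: y) -> L (f ^+ k *: y).
  apply: (noethM (N := fun i => [set y | L (f ^+ i *: y)])) => [i|i y /= Ly].
    split=> /= [|y z Ly Lz|a y Ly]; first by rewrite scaler0.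
      by rewrite scalerDr; apply: LD.
    by rewrite scalerA mulrC -scalerA; apply: LZ.
  by rewrite exprS -scalerA; apply: LZ.
exists k => y.
pose L' := [set z | exists y, L (z - f ^+ k *: y)].
apply: (maxL L').
- split=> [|a b [c La] [e Lb]|a b [c Lb]].
  + by exists 0; rewrite scaler0 subr0.
  + by exists (c + e); rewrite scalerDr opprD addrACA; apply: LD.
  + by exists (a *: c); rewrite scalerA mulrC -scalerA -scalerBr; apply: LZ.
(* If [x] is [f ^+ k *: z] modulo [L], then [f *: x] in [L] puts [f ^+ k.+1 *: z] in [L], hence
   [f ^+ k *: z] by stationarity, hence [x]. *)
- move=> [z Lz]; apply: Lx; rewrite -(subrK (f ^+ k *: z) x); apply: LD => //.
  apply: (hk k.+1); rewrite exprS -scalerA.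
  have -> : f *: (f ^+ k *: z) = f *: x - f *: (x - f ^+ k *: z).
    by rewrite scalerBr subKr.
  by apply: submodB => //; apply: LZ.
- by move=> z Lz; exists 0; rewrite scaler0 subr0.
- by exists y; rewrite subrr.
Qed.

(** The first clause puts the points in the zero set of the annihilator of [M / N]; this is what
    later makes their coordinates nonzero. The second is the separation property, with the power of
    the maximal ideal expressed on its generators. *)
Definition localizing N Om :=
  (forall w, w \in Om -> forall f : T, (forall x, N (f *: x)) ->
     meval (w 0) f = 0) /\
  (forall x, ~ N x -> exists2 w, w \in Om & exists L,
     [/\ submod L, N `<=` L, ~ L x &
         exists K, forall i y, L (('X_i - (w 0 i)%:MP) ^+ K *: y)]).

Definition meet_irreducible N := forall N1 N2, submod N1 -> submod N2 ->
  N `<=` N1 -> N `<=` N2 -> N1 `&` N2 `<=` N -> N1 `<=` N \/ N2 `<=` N.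

Lemma localizing_irreducible N x0 : submod N -> ~ N x0 -> meet_irreducible N ->
  exists w, localizing N [:: w].
Proof.
move=> sN Nx0 irrN; case: (sN) => N0 ND NZ.
pose ker (f : T) := [set x | N (f *: x)].
have sker f : submod (ker f) /\ N `<=` ker f.
  split; last by move=> x; apply: NZ.
  split=> [|x y Nx Ny|a x Nx]; rewrite /ker /=; first by rewrite scaler0.
    by rewrite scalerDr; apply: ND.
  by rewrite scalerA mulrC -scalerA; apply: NZ.
pose p : set T^o := [set f | exists2 x, ~ N x & N (f *: x)].
have kerp f : p f -> ~ (ker f `<=` N) by move=> [x Nx Nfx] /(_ x Nfx).
have sp : submod p.
  split=> [|f g pf pg|a f [x Nx Nfx]].
  - by exists x0 => //; rewrite scale0r.
  (* If [f] and [g] are zero divisors of [M / N], both kernels properly contain [N]; by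
     irreducibility they share an [x] outside [N], which [f + g] kills. *)
  - have [sf Nf] := sker f; have [sg Ng] := sker g.
    apply: contrapT => npfg.
    have [] := irrN _ _ sf sg Nf Ng; [|exact: kerp|exact: kerp].
    move=> x [Nfx Ngx]; apply: contrapT => Nx; apply: npfg; exists x => //.
    by rewrite scalerDl; apply: ND.
  - by exists x => //; rewrite -scalerA; apply: NZ.
have [|w wP] := weak_nullstellensatz sp.
  by move=> [x Nx]; rewrite scale1r.
exists w; split=> [_ /[1!inE]/eqP -> f Nf|x Nx].
  by apply: wP; exists x0.
exists w; first exact: mem_head.
pose L0 := [set y | exists2 a : T, meval (w 0) a = 0 & N (y - a *: x)].
have sL0 : submod L0.
  split=> [|y z [a wa Ny] [b wb Nz]|e y [a wa Ny]].
  - by exists 0; rewrite ?meval0 // scale0r subr0.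
  - exists (a + b); first by rewrite mevalD wa wb addr0.
    by rewrite scalerDl opprD addrACA; apply: ND.
  - exists (e * a); first by rewrite mevalM wa mulr0.
    by rewrite -scalerA -scalerBr; apply: NZ.
have L0x : ~ L0 x.
  move=> [a wa Na]; have : p (1 - a).
    by exists x => //; rewrite scalerBl scale1r.
  by move/wP; rewrite mevalB wa meval1 subr0 => /eqP; rewrite oner_eq0.
have [|L [[sL Lx] L0L maxL]] := noetherian_max
  (P := [set L | submod L /\ ~ L x]) noethM _ (conj sL0 L0x).
  by move=> L [].
exists L; split=> //.
  by move=> y Ny; apply: L0L; exists 0; rewrite ?meval0 // scale0r subr0.
have nil i : exists k, forall y, L (('X_i - (w 0 i)%:MP) ^+ k *: y).
  apply: (maximal_avoiding_nilpotent sL Lx) => [L' sL' L'x|]; first exact: maxL.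
  apply: L0L; exists ('X_i - (w 0 i)%:MP); last by rewrite subrr.
  by rewrite mevalB mevalXU mevalC subrr.
have [k hk] := choice nil.
exists (\max_i k i)%N => i y.
rewrite -(subnK (leq_bigmax i)) exprD -scalerA.
by case: sL => _ _; apply.
Qed.

Lemma finite_localization N : submod N -> exists Om, localizing N Om.
Proof.
move=> sN; apply: contrapT => nN.
have [|N' [[sN' nN'] _ maxN']] := noetherian_max
  (P := [set N | submod N /\ ~ exists Om, localizing N Om]) noethM _ (conj sN nN).
  by move=> L [].
have good N1 : submod N1 -> N' `<=` N1 -> ~ (N1 `<=` N') ->
    exists Om, localizing N1 Om.
  by move=> sN1 s1 n1; apply: contrapT => nex; apply: n1; apply: maxN'.
apply: nN'; have [[x0 Nx0]|full] := pselect (exists x, ~ N' x); last first.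
  by exists [::]; split=> // x Nx; case: full; exists x.
have [irr|red] := pselect (meet_irreducible N').
  by have [w] := localizing_irreducible sN' Nx0 irr; exists [:: w].
have [N1 [N2 [sN1 sN2 s1 [s2 s12 [n1 n2]]]]] : exists N1 N2,
    [/\ submod N1, submod N2, N' `<=` N1 & [/\ N' `<=` N2, N1 `&` N2 `<=` N'
      & ~ (N1 `<=` N') /\ ~ (N2 `<=` N')]].
  apply: contrapT => nex; apply: red => N1 N2 sN1 sN2 s1 s2 s12.
  have [|n1] := pselect (N1 `<=` N'); first by left.
  have [|n2] := pselect (N2 `<=` N'); first by right.
  by case: nex; exists N1, N2.
have [Om1 [z1 l1]] := good _ sN1 s1 n1; have [Om2 [z2 l2]] := good _ sN2 s2 n2.
exists (Om1 ++ Om2); split=> [w|x Nx].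
  rewrite mem_cat => /orP[wO|wO] f Nf.
    by apply: z1 wO _ _ => x; apply: s1.
  by apply: z2 wO _ _ => x; apply: s2.
have [N1x|/l1[w wO [L [sL NL Lx K]]]] := pselect (N1 x); last first.
  exists w; first by rewrite mem_cat wO.
  by exists L; split=> //; apply: subset_trans NL.
have /l2[w wO [L [sL NL Lx K]]] : ~ N2 x by move=> N2x; apply: Nx; apply: s12.
exists w; first by rewrite mem_cat wO orbT.
by exists L; split=> //; apply: subset_trans NL.
Qed.

End FiniteLocalization.

(** * Linear functionals vanishing on a subspace *)

Section Separation.
Variables (F : fieldType) (T : comNzRingType) (iota : {rmorphism F -> T}).
Variable M : lmodType T.

Definition subspace (H : set M) := [/\ H 0,
  forall x y, H x -> H y -> H (x + y) & forall c x, H x -> H (iota c *: x)].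

(** Zorn's lemma gives a maximal subspace [H] containing [L] but not [x]. It is a complement of the
    line through [x], and [g] reads off the coefficient of [x]. *)
Lemma separating_functional (L : set M) x : subspace L -> ~ L x ->
  exists g : M -> F, [/\ {morph g : y z / y + z},
    forall c y, g (iota c *: y) = c * g y, forall y, L y -> g y = 0 & g x = 1].
Proof.
move=> sL Lx.
pose P := [set H | H = set0 \/ [/\ subspace H, L `<=` H & ~ H x]].
have [G GP totG|H [PH maxH]] := @Zorn_bigcup M P.
  have [[H0 [G0 [sH0 LH0 H0x]]]|nG] := pselect (exists H, G H /\
      [/\ subspace H, L `<=` H & ~ H x]); last first.
    left; apply/seteqP; split=> // y [H GH Hy].
    by case: (GP H GH) => [H0|?]; [rewrite H0 in Hy|case: nG; exists H].
  right; have inh H y : G H -> H y -> [/\ subspace H, L `<=` H & ~ H x].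
    by move=> GH Hy; case: (GP H GH) => // H0'; rewrite H0' in Hy.
  split; [split| |].
  - by exists H0 => //; case: sH0.
  - move=> y z [H GH Hy] [K GK Kz]; have [HK|KH] := totG _ _ GH GK.
      by exists K => //; have [[_ + _] _ _] := inh _ _ GK Kz; apply=> //; apply: HK.
    by exists H => //; have [[_ + _] _ _] := inh _ _ GH Hy; apply=> //; apply: KH.
  - move=> c y [H GH Hy]; exists H => //.
    by have [[_ _ +] _ _] := inh _ _ GH Hy; apply.
  - by move=> y Ly; exists H0 => //; apply: LH0.
  - by move=> [H GH Hx]; have [_ _] := inh _ _ GH Hx; apply.
have {PH} [sH LH Hx] : [/\ subspace H, L `<=` H & ~ H x].
  case: PH => // H0; exfalso; apply: (maxH L); last by right; split.
  by rewrite H0; split=> // /(_ 0); apply; case: sL.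
case: (sH) => H0 HD HZ.
have HN y : H y -> H (- y).
  by move=> Hy; rewrite -scaleN1r -(rmorph1 iota) -rmorphN; apply: HZ.
(* For [y] outside [H], maximality puts [x] in [H + F y]; the coefficient of [y] is nonzero, and
   dividing by it solves for [y]. *)
have ex y : exists c, H (y - iota c *: x).
  have [Hy|Hy] := pselect (H y); first by exists 0; rewrite rmorph0 scale0r subr0.
  pose H' := [set z | exists c, H (z - iota c *: y)].
  have HH' : H `<=` H' by move=> z Hz; exists 0; rewrite rmorph0 scale0r subr0.
  have [c Hc] : H' x.
    apply: contrapT => H'x; apply: (maxH H').
      split=> // /(_ y) H'y; apply: Hy; apply: H'y.
      by exists 1; rewrite rmorph1 scale1r subrr.
    right; split=> //; last exact: subset_trans LH HH'.
    split=> [|z t [c Hz] [e Ht]|c z [e Hz]]; first exact: HH'.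
      by exists (c + e); rewrite rmorphD scalerDl opprD addrACA; apply: HD.
    by exists (c * e); rewrite rmorphM -scalerA -scalerBr; apply: HZ.
  have [c0|c0] := eqVneq c 0; first by move: Hc; rewrite c0 rmorph0 scale0r subr0.
  exists c^-1; have := HN _ (HZ c^-1 _ Hc).
  by rewrite scalerBr scalerA -rmorphM mulVf // rmorph1 scale1r opprB.
have uniq y c e : H (y - iota c *: x) -> H (y - iota e *: x) -> c = e.
  move=> Hc He; apply/eqP; apply: contrapT => /negP ce; apply: Hx.
  have ce0 : c - e != 0 by rewrite subr_eq0.
  have := HZ (c - e)^-1 _ (HD _ _ He (HN _ Hc)).
  rewrite subrBB subrr sub0r opprB -scalerBl -rmorphB scalerA -rmorphM mulVf //.
  by rewrite rmorph1 scale1r.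
have [g gP] := choice ex; exists g; split.
- move=> y z; apply: (uniq (y + z)) => //.
  by rewrite rmorphD scalerDl opprD addrACA; apply: HD.
- move=> c y; apply: (uniq (iota c *: y)) => //.
  by rewrite rmorphM -scalerA -scalerBr; apply: HZ.
- by move=> y Ly; apply: (uniq y) => //; rewrite rmorph0 scale0r subr0; apply: LH.
- by apply: (uniq x) => //; rewrite rmorph1 scale1r subrr.
Qed.

End Separation.

(** * Finite differences and pg-sequences *)

Section FiniteDifferences.
Variables (R : realType) (d : nat).
Local Notation C := R[i].
Local Notation Zd := 'rV[int]_d.
Implicit Types (u : Zd -> C) (k : Zd) (i j : 'I_d).

Let zero : Zd -> C := fun=> 0.

Definition fdiff i u : Zd -> C := fun k => u (k + gen i) - u k.

Lemma fdiffC i j u : fdiff i (fdiff j u) = fdiff j (fdiff i u).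
Proof. by apply/funext => k; rewrite /fdiff subrBB (addrAC k). Qed.

Lemma fdiff_iterC i j m u : fdiff j (iter m (fdiff i) u) = iter m (fdiff i) (fdiff j u).
Proof. by elim: m => [//|m IH]; rewrite iterS fdiffC IH. Qed.

Lemma iter_fdiffC i j m N u : iter N (fdiff j) (iter m (fdiff i) u) =
  iter m (fdiff i) (iter N (fdiff j) u).
Proof. by elim: N => [//|N IH]; rewrite !iterS IH fdiff_iterC. Qed.

Lemma iter_fdiff0 i m : iter m (fdiff i) zero = zero.
Proof. by elim: m => [//|m IH]; rewrite iterS IH; apply/funext => k; apply: subrr. Qed.

Lemma fdiff0_invariant i u : fdiff i u = zero ->
  forall k (a : int), u (k + a *: gen i) = u k.
Proof.
move=> ui; have uS k : u (k + gen i) = u k.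
  by apply/eqP; rewrite -subr_eq0; apply/eqP; rewrite -[LHS]/(fdiff i u k) ui.
move=> k; elim/int_rect => [|a IH|a IH]; first by rewrite scale0r addr0.
  by rewrite intS scalerDl scale1r [gen i + _]addrC addrA uS.
by rewrite -[LHS]uS intS opprD scalerDl scaleN1r [- gen i + _]addrC addrA subrK.
Qed.

Definition zap i k : Zd := k - k 0 i *: gen i.

Lemma zapDgen i j k : zap i (k + gen j) = if j == i then zap i k else zap i k + gen j.
Proof.
rewrite /zap /gen !mxE eqxx /= eq_sym; case: eqVneq => [->|_] /=.
  by rewrite scalerDl scale1r opprD addrACA subrr addr0.
by rewrite addr0 addrAC.
Qed.

Lemma zap_zap i k : zap i (zap i k) = zap i k.
Proof. by rewrite {1}/zap /zap !mxE !eqxx mulr1 subrr scale0r subr0. Qed.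

(** The generalised binomial coefficient [x (x - 1) ... (x - m + 1) / m!]. *)
Fixpoint binom m (x : C) : C :=
  if m is m'.+1 then binom m' x * (x - m'%:R) / m'.+1%:R else 1.

Lemma binomS m x : binom m.+1 (x + 1) - binom m.+1 x = binom m x.
Proof.
elim: m x => [|m IH] x.
  by rewrite /= !mul1r !subr0 divr1 divr1 addrAC subrr add0r.
have m0 : (m.+2%:R : C) != 0 by rewrite pnatr_eq0.
have m1 : (m.+1%:R : C) != 0 by rewrite pnatr_eq0.
have -> : binom m.+2 (x + 1) = (binom m.+1 x + binom m x) * (x + 1 - m.+1%:R) / m.+2%:R.
  by rewrite -(IH x) addrCA subrr addr0.
have E : binom m x * (x - m%:R) = m.+1%:R * binom m.+1 x.
  by rewrite [binom m.+1 x]/= [RHS]mulrC mulfVK.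
have -> : binom m.+2 x = binom m.+1 x * (x - m.+1%:R) / m.+2%:R by [].
rewrite -mulrBl; apply: (mulIf m0); rewrite mulfVK //.
have -> : x + 1 - m.+1%:R = x - m%:R by rewrite -natr1; ring.
rewrite mulrDl E -(natr1 m.+1) -natr1; ring.
Qed.

Lemma binom0 m : binom m 0 = (m == 0%N)%:R.
Proof.
elim: m => [//|m IH]; rewrite [LHS]/= IH; case: m {IH} => [|m] /=.
  by rewrite subr0 mulr0 mul0r.
by rewrite !mul0r.
Qed.

Fixpoint mbinom i m : {mpoly C[d]} :=
  if m is m'.+1 then (m'.+1%:R)^-1 *: (mbinom i m' * ('X_i - (m'%:R)%:MP)) else 1.

Lemma meval_mbinom i m (v : 'I_d -> C) : meval v (mbinom i m) = binom m (v i).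
Proof.
elim: m => [|m IH] /=; first by rewrite meval1.
by rewrite mevalZ mevalM IH mevalB mevalXU mevalC mulrC.
Qed.

(** Newton's forward difference formula in direction [i]. By induction and Pascal's rule both sides
    have the same difference along [i], and they agree where the [i]-th coordinate is 0. *)
Lemma newton i N u : iter N (fdiff i) u = zero -> forall k,
  u k = \sum_(m < N) binom m (k 0 i)%:~R * iter m (fdiff i) u (zap i k).
Proof.
elim: N u => [|N IH] u uN k; first by rewrite big_ord0 -[u]/(iter 0 (fdiff i) u) uN.
pose w k := \sum_(m < N.+1) binom m (k 0 i)%:~R * iter m (fdiff i) u (zap i k).
have Dw : fdiff i (fun k => u k - w k) = zero.
  apply/funext => l; rewrite /fdiff subrBB -[u _ - _]/(fdiff i u l).
  rewrite (IH (fdiff i u)) -?iterSr // /w -sumrB big_ord_recl zapDgen eqxx.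
  rewrite [X in _ - (X + _)]subrr add0r.
  rewrite -sumrB big1 // => m _; rewrite lift0 -mulrBl.
  rewrite -fdiff_iterC -iterS.
  have -> : (l + gen i) 0 i = l 0 i + 1 by rewrite /gen !mxE !eqxx.
  by rewrite rmorphD /= binomS subrr.
have kE : k = zap i k + k 0 i *: gen i by rewrite subrK.
have /eqP := fdiff0_invariant Dw (zap i k) (k 0 i).
rewrite -kE [X in _ == X](_ : _ = 0); first by rewrite subr_eq0 => /eqP.
rewrite /w big_ord_recl big1 => [|m _]; last first.
  by rewrite /zap /gen !mxE !eqxx mulr1 subrr binom0 mul0r.
by rewrite zap_zap /= mul1r addr0 subrr.
Qed.

Lemma polynomial_of_fdiff N u (S : seq 'I_d) :
  (forall i, iter N.+1 (fdiff i) u = zero) ->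
  (forall i, i \notin S -> fdiff i u = zero) ->
  exists h : {mpoly C[d]}, forall k, u k = meval (fun i => (k 0 i)%:~R) h.
Proof.
elim: S u => [|i S IH] u uN uS.
  exists (u 0)%:MP => k; rewrite mevalC -[k]add0r [k]row_sum_delta.
  apply: (big_ind (fun x => forall l, u (l + x) = u l)) => [l|x y ux uy l|j _ l].
  - by rewrite addr0.
  - by rewrite addrA uy ux.
  - by apply: fdiff0_invariant; apply: uS.
(* The Newton coefficients of [u] along [i] do not depend on the [i]-th coordinate, so the induction
   hypothesis for [S] applies to them. *)
pose um m := iter m (fdiff i) u \o zap i.
have fz j v : fdiff j (v \o zap i) = if j == i then zero else fdiff j v \o zap i.
  apply/funext => k; rewrite /fdiff /= zapDgen.
  by case: eqVneq => //= _; rewrite subrr.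
have ex (m : nat) : exists h : {mpoly C[d]},
    forall k, um m k = meval (fun i => (k 0 i)%:~R) h.
  apply: IH => j.
    have [->|ji] := eqVneq j i; first by rewrite iterSr fz eqxx iter_fdiff0.
    have izap v a : iter a (fdiff j) (v \o zap i) = iter a (fdiff j) v \o zap i.
      by elim: a => [//|a IHa]; rewrite !iterS IHa fz (negPf ji).
    by rewrite izap iter_fdiffC uN iter_fdiff0.
  rewrite fz; case: eqVneq => //= ji jS.
  by rewrite fdiff_iterC uS ?iter_fdiff0 // inE negb_or ji.
have [h hP] := choice ex.
exists (\sum_(m < N.+1) mbinom i m * h m) => k.
rewrite (newton (uN i)) raddf_sum; apply: eq_bigr => m _.
by rewrite /= mevalM meval_mbinom -hP.
Qed.

End FiniteDifferences.

Section PgSequences.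
Variables (R : realType) (d r : nat) (w : 'rV[R[i]]_d).
Hypothesis w0 : in_Cstar w.
Local Notation C := R[i].
Local Notation Zd := 'rV[int]_d.

Definition wdiff i (x : Zd -> C) : Zd -> C := fun k => x (k + gen i) - w 0 i * x k.

Lemma gpow_neq0 k : gpow w k != 0.
Proof. by apply/prodf_neq0 => i _; apply: expfz_neq0; apply: w0. Qed.

Lemma gpowDgen k i : gpow w (k + gen i) = w 0 i * gpow w k.
Proof.
rewrite /gpow (bigD1 i) //= [in RHS](bigD1 i) //= mulrA.
congr (_ * _); first by rewrite /gen !mxE !eqxx expfzDr ?w0 // expr1z mulrC.
by apply: eq_bigr => j ji; rewrite /gen !mxE eqxx (negPf ji) addr0.
Qed.

(** Division by [gpow w] turns the twisted difference into the ordinary one up to the factor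
    [w 0 i], which reduces pg-sequences to polynomials. *)
Lemma iter_fdiff_twist i a x : iter a (fdiff i) (fun k => (gpow w k)^-1 * x k) =
  fun k => (w 0 i) ^- a * ((gpow w k)^-1 * iter a (wdiff i) x k).
Proof.
elim: a => [|a IH]; first by apply/funext => k; rewrite expr0 invr1 mul1r.
apply/funext => k; rewrite iterS IH /fdiff gpowDgen invfM exprS invfM /= /wdiff.
have wi := w0 i; have gk := gpow_neq0 k.
have aw : w 0 i ^+ a != 0 by rewrite expf_neq0.
set y := iter a _ x; field; by rewrite wi gk aw.
Qed.

Lemma is_pg_of_wdiff K (v : vseq R d r) :
  (forall i j k, iter K (wdiff i) (fun k => v k j) k = 0) -> is_pg w v.
Proof.
move=> vK.
have ex j : exists h : {mpoly C[d]}, forall k,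
    (gpow w k)^-1 * v k j = meval (fun i => (k 0 i)%:~R) h.
  apply: (@polynomial_of_fdiff _ _ K _ (enum 'I_d)) => i; last by rewrite mem_enum.
  rewrite iterS iter_fdiff_twist; apply/funext => k.
  by rewrite /fdiff !vK !mulr0 subrr.
have [h hP] := choice ex.
by exists h => k j; rewrite -hP mulVKf // gpow_neq0.
Qed.

End PgSequences.

(** * Duality *)

Section MonomialPairing.
Variables (F : fieldType) (n : nat) (phi : 'X_{1..n} -> F).
Local Notation T := {mpoly F[n]}.

Definition mpair (p : T) : F := \sum_(m <- msupp p) p@_m * phi m.

(** The support varies with [p]; over a common range of monomials the sum is visibly linear in
    [p]. *)
Lemma mpairE K p : (msize p <= K)%N ->
  mpair p = \sum_(m : 'X_{1..n < K}) p@_m * phi m.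
Proof.
move=> pK; pose I : subFinType _ := 'X_{1..n < K}.
rewrite /mpair (ssrcomplements.big_mksub I) ?msupp_uniq //=; last first.
  by move=> x /msize_mdeg_lt /leq_trans; apply.
by rewrite big_rmcond //= => j /memN_msupp_eq0 ->; rewrite mul0r.
Qed.

Lemma mpair_is_linear : linear_for *%R mpair.
Proof.
move=> c p q; pose K := maxn (msize (c *: p + q)) (maxn (msize p) (msize q)).
rewrite !(@mpairE K) ?leq_max ?leqnn ?orbT // mulr_sumr -big_split /=.
by apply: eq_bigr => m _; rewrite mcoeffD mcoeffZ mulrDl mulrA.
Qed.

HB.instance Definition _ := GRing.isLinear.Build F T F *%R mpair mpair_is_linear.

Lemma mpairX m : mpair 'X_[m] = phi m.
Proof. by rewrite /mpair msuppX big_seq1 mcoeffX eqxx mul1r. Qed.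

End MonomialPairing.

Lemma mpairMX (F : fieldType) (n : nat) (phi : 'X_{1..n} -> F) m p :
  mpair phi ('X_[m] * p) = mpair (fun m' => phi (m + m')%MM) p.
Proof.
elim/mpolyind: p => [|c m' p _ _ IH]; first by rewrite mulr0 !raddf0.
by rewrite mulrDr -scalerAr -mpolyXD !raddfD /= !linearZ /= !mpairX IH.
Qed.

Lemma scaler_diff (T : comNzRingType) (M : lmodType T) (a b c e : T) (x : M) :
  a *: ((b * c) *: x) - e *: (a *: (b *: x)) = (a * (c - e)) *: (b *: x).
Proof. by rewrite !scalerA -scalerBl; congr (_ *: _); ring. Qed.

(* Laurent polynomials in [d] variables are handled as polynomials in [d + d]
   variables, the last [d] of which act as the inverses of the first [d]. *)
Section LaurentDuality.
Variables (R : realType) (d r : nat).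
Local Notation C := R[i].
Local Notation Zd := 'rV[int]_d.
Local Notation T := {mpoly C[d + d]}.
Local Notation M := 'rV[T]_r.
Implicit Types (u v : vseq R d r) (f g : M) (A P : vseq R d r -> Prop).

Definition lexp (m : 'X_{1..d + d}) : Zd :=
  \row_i ((m (lshift d i))%:Z - (m (rshift d i))%:Z).

Lemma lexpD m m' : lexp (m + m')%MM = lexp m + lexp m'.
Proof. by apply/rowP => i; rewrite !mxE !mnmDE !PoszD opprD addrACA. Qed.

Lemma lexpUl i : lexp U_(lshift d i) = gen i.
Proof.
apply/rowP => j; rewrite /gen !mxE !mnm1E eq_lrshift subr0 eq_lshift eqxx /=.
by rewrite eq_sym; case: eqP.
Qed.

Lemma lexpUr i : lexp U_(rshift d i) = - gen i.
Proof.
apply/rowP => j; rewrite /gen !mxE !mnm1E eq_rlshift sub0r eq_rshift eqxx /=.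
by rewrite eq_sym; case: eqP.
Qed.

(** A section of [lexp]: positive parts go to the first [d] variables, negative parts to the last
    [d]. [Negz b] stands for [-(b + 1)]. *)
Definition lmon (k : Zd) : 'X_{1..d + d} :=
  [multinom match split i with
            | inl a => if k 0%R a is Posz b then b else 0%N
            | inr a => if k 0%R a is Negz b then b.+1 else 0%N end | i < d + d].

Lemma lmonK k : lexp (lmon k) = k.
Proof.
apply/rowP => i; rewrite !mxE !mnmE.
rewrite -[lshift d i]/(unsplit (inl i)) -[rshift d i]/(unsplit (inr i)) !unsplitK.
by case: (k 0 i) => a /=; rewrite ?subr0 ?sub0r ?NegzE.
Qed.

Definition lpair f u : C := \sum_j mpair (fun m => u (lexp m) j) (f 0 j).

Lemma lpairD u : {morph lpair^~ u : f g / f + g}.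
Proof.
move=> f g; rewrite /lpair -big_split; apply: eq_bigr => j _.
by rewrite mxE raddfD.
Qed.

Lemma lpairB f g u : lpair (f - g) u = lpair f u - lpair g u.
Proof.
rewrite /lpair -sumrB; apply: eq_bigr => j _.
by rewrite !mxE raddfB.
Qed.

Lemma lpairZ c f u : lpair (c%:MP *: f) u = c * lpair f u.
Proof.
rewrite /lpair mulr_sumr; apply: eq_bigr => j _.
by rewrite mxE mul_mpolyC linearZ.
Qed.

Lemma lpair0 u : lpair 0 u = 0.
Proof. by rewrite /lpair big1 // => j _; rewrite mxE raddf0. Qed.

(** Multiplication by a monomial is dual to translation; this makes the annihilator of an invariant
    subspace a submodule. *)
Lemma lpairX m f u : lpair ('X_[m] *: f) u = lpair f (fun k => u (lexp m + k)).
Proof.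
apply: eq_bigr => j _; rewrite mxE mpairMX.
by congr mpair; apply/funext => m'; rewrite lexpD.
Qed.

Lemma lpair_delta m j u : lpair ('X_[m] *: delta_mx 0 j) u = u (lexp m) j.
Proof.
rewrite /lpair (bigD1 j) //= big1 => [|k kj]; rewrite !mxE eqxx.
  by rewrite eqxx mulr1 mpairX addr0.
by rewrite (negPf kj) mulr0 raddf0.
Qed.

Lemma lpair_functional (g : M -> C) v : {morph g : x y / x + y} ->
  (forall c x, g (c%:MP *: x) = c * g x) ->
  (forall m j, g ('X_[m] *: delta_mx 0 j) = v (lexp m) j) ->
  forall f, g f = lpair f v.
Proof.
move=> gD gZ gX f.
have g0 : g 0 = 0 by rewrite -(scale0r 0) -mpolyC0 gZ mul0r.
rewrite [in LHS](row_sum_delta f) (big_morph g gD g0); apply: eq_bigr => j _.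
elim/mpolyind: (f 0 j) => [|c m p _ _ IH]; first by rewrite scale0r g0 raddf0.
rewrite [RHS]linearP /= mpairX -IH -gX -gZ -gD; congr g.
by rewrite scalerDl scalerA mul_mpolyC.
Qed.

(** A basic neighbourhood of [u] missing [P] involves a finite set [F] of points. Restriction to [F]
    reduces the claim to a space of matrices, and a functional there is pairing with a vector of
    polynomials. *)
Lemma pw_separation P u : is_subspace P -> ~ pw_closure P u ->
  exists f, (forall v, P v -> lpair f v = 0) /\ lpair f u <> 0.
Proof.
move=> [P0 PD PZ] nPu.
have [F [e [e0 Fe]]] : exists (F : seq Zd) (e : R), 0 < e /\ forall v, P v ->
    ~ forall k, k \in F -> forall j, `|v k j - u k j| < e%:C%C.
  apply: contrapT => nex; apply: nPu => F e e0; apply: contrapT => nv; apply: nex.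
  by exists F, e; split=> // v Pv Fv; apply: nv; exists v.
pose rho v : 'M[C]_(size F, r) := \matrix_(a, j) v (nth 0 F a) j.
have [||g [gD gZ gP gu]] := @separating_functional C C idfun
    'M[C]_(size F, r) [set x | exists2 v, P v & x = rho v] (rho u).
- split=> [|_ _ [x Px ->] [y Py ->]|c _ [x Px ->]].
  + by exists (fun _ _ => 0) => //; apply/matrixP => a j; rewrite !mxE.
  + exists (fun k j => x k j + y k j); first exact: PD.
    by apply/matrixP => a j; rewrite !mxE.
  + exists (fun k j => c * x k j); first exact: PZ.
    by apply/matrixP => a j; rewrite !mxE.
- move=> [v Pv uv]; apply: (Fe v Pv) => k kF j.
  move/matrixP/(_ (Ordinal (etrans (index_mem k F) kF)) j): uv.
  by rewrite !mxE /= nth_index // => ->; rewrite subrr normr0 ltcR.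
have {}gZ (c : C) y : g (c *: y) = c * g y := gZ c y.
have g0 : g 0 = 0 by rewrite -(scale0r 0) gZ mul0r.
pose f : M := \row_j \sum_a (g (delta_mx a j) *: 'X_[lmon (nth 0 F a)]).
have fE v : lpair f v = g (rho v).
  rewrite [rho v]matrix_sum_delta (big_morph g gD g0).
  under [RHS]eq_bigr => a _ do rewrite (big_morph g gD g0).
  rewrite exchange_big; apply: eq_bigr => j _; rewrite mxE raddf_sum.
  by apply: eq_bigr => a _; rewrite gZ mxE mulrC /= linearZ /= mpairX lmonK.
exists f; split=> [v Pv|]; first by rewrite fE gP //; exists v.
by rewrite fE gu; apply/eqP; apply: oner_neq0.
Qed.

Definition annihilator A : set M := [set f | forall u, A u -> lpair f u = 0].

Lemma submod_annihilator A : is_invariant A -> submod (annihilator A).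
Proof.
move=> iA; apply: submod_mpoly => [u _|f g Nf Ng u Au|c f Nf u Au|i f Nf u Au].
- exact: lpair0.
- by rewrite lpairD Nf // Ng // addr0.
- by rewrite lpairZ Nf // mulr0.
- rewrite lpairX; apply: Nf.
  (* The two kinds of variables translate in opposite directions, so both halves of invariance are
     used. *)
  case: (split_ordP i) => a ->; rewrite ?lexpUl ?lexpUr.
    have [_ /(_ u Au)[v [Av <-]]] := iA a.
    by rewrite (_ : (fun k => _) = v) //; apply/funext => k;
      rewrite /shift addrAC subrr add0r.
  have [/(_ u Au) + _] := iA a; congr A.
  by apply/funext => k; rewrite /shift addrC.
Qed.

Lemma annihilator_localizing A : is_invariant A ->
  exists Om, localizing (annihilator A) Om.
Proof.
move=> iA; apply: finite_localization (submod_annihilator iA).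
exact: noetherian_rV.
Qed.

Lemma annihilatorK A u : is_subspace A -> pw_closed A ->
  (forall f, annihilator A f -> lpair f u = 0) -> A u.
Proof.
move=> sA cA uN; apply: cA; apply: contrapT => /(pw_separation sA)[f [fA fu]].
exact: fu (uN f fA).
Qed.

Lemma lin_span_subspace (S : vseq R d r -> Prop) : is_subspace (lin_span S).
Proof.
split.
- exists 0%N, (fun _ _ _ => 0), (fun=> 0); split=> [[]//|].
  by apply/funext => k; apply/funext => j; rewrite big_ord0.
- move=> _ _ [n1 [f1 [c1 [S1 ->]]]] [n2 [f2 [c2 [S2 ->]]]].
  exists (n1 + n2)%N,
    (fun m => match split m with inl a => f1 a | inr b => f2 b end),
    (fun m => match split m with inl a => c1 a | inr b => c2 b end).
  split=> [m|]; first by case: (split m).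
  apply/funext => k; apply/funext => j; rewrite big_split_ord /=.
  by congr (_ + _); apply: eq_bigr => m _;
    rewrite ?(unsplitK (inl m)) ?(unsplitK (inr m)).
- move=> a _ [n [f [c [Sf ->]]]]; exists n, f, (fun m => a * c m); split=> //.
  apply/funext => k; apply/funext => j; rewrite mulr_sumr.
  by apply: eq_bigr => m _; rewrite mulrA.
Qed.

Lemma sub_lin_span (S : vseq R d r -> Prop) u : S u -> lin_span S u.
Proof.
move=> Su; exists 1%N, (fun=> u), (fun=> 1); split=> //.
by apply/funext => k; apply/funext => j; rewrite big_ord1 mul1r.
Qed.

Lemma lin_span_sub (S A : vseq R d r -> Prop) : is_subspace A ->
  (forall u, S u -> A u) -> forall u, lin_span S u -> A u.
Proof.
move=> [A0 AD AZ] SA _ [n [f [c [Sf ->]]]]; elim: n f c Sf => [|n IH] f c Sf.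
  by congr A: A0; apply/funext => k; apply/funext => j; rewrite big_ord0.
have := AD _ _ (IH (fun m => f (lift ord0 m)) (fun m => c (lift ord0 m))
  (fun m => Sf _)) (AZ (c ord0) _ (SA _ (Sf ord0))).
by congr A; apply/funext => k; apply/funext => j; rewrite big_ord_recl addrC.
Qed.

(** Since [g] kills the annihilator, it takes equal values on monomials with equal [lexp], hence is
    pairing with some [v], and [v] is in [A] by biduality. The powers killed by [g] become the
    vanishing twisted differences of [v]. *)
Lemma pg_functional A (w : 'rV[C]_(d + d)) K (g : M -> C) :
  is_subspace A -> pw_closed A -> in_Cstar (lsubmx w) ->
  {morph g : x y / x + y} -> (forall c x, g (c%:MP *: x) = c * g x) ->
  (forall f, annihilator A f -> g f = 0) ->
  (forall i f, g (('X_i - (w 0 i)%:MP) ^+ K *: f) = 0) ->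
  exists v, [/\ A v, is_pg (lsubmx w) v & forall f, g f = lpair f v].
Proof.
move=> sA cA w0 gD gZ gN gK.
pose v : vseq R d r := fun k j => g ('X_[lmon k] *: delta_mx 0 j).
have gB x y : g (x - y) = g x - g y.
  by rewrite gD -scaleN1r -mpolyC1 -mpolyCN gZ mulN1r.
have gX m j : g ('X_[m] *: delta_mx 0 j) = v (lexp m) j.
  apply/eqP; rewrite -subr_eq0 /v -gB; apply/eqP/gN => u _.
  rewrite lpairB; apply/eqP; rewrite subr_eq0; apply/eqP.
  apply: etrans (lpair_delta m j u) (esym _).
  by apply: etrans (lpair_delta _ j u) _; rewrite lmonK.
have gE := lpair_functional gD gZ gX.
exists v; split=> //; first by apply: (annihilatorK sA cA) => f /gN; rewrite gE.
apply: (is_pg_of_wdiff w0 (K := K)) => i j k; rewrite -(lmonK k).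
rewrite -(gK (lshift d i) ('X_[lmon k] *: delta_mx 0 j)).
elim: K {gK} (lmon k) => [|a IH] m; first by rewrite expr0 scale1r gX.
rewrite iterS {1}/wdiff -lexpUl -lexpD !IH mxE -gZ -gB; congr g.
by rewrite exprSr mpolyXD; apply: scaler_diff.
Qed.

End LaurentDuality.

(** * Spectral synthesis for closed invariant subspaces *)

Theorem theorem4p10 (R : realType) (d r : nat) (A : vseq R d r -> Prop) :
  is_subspace A -> pw_closed A -> is_invariant A ->
  exists Omega : seq 'rV[R[i]]_d,
    (forall w, w \in Omega -> in_Cstar w) /\
    (forall u, A u <->
       closed_span (fun v => A v /\ exists2 w, w \in Omega & is_pg w v) u).
Proof.
move=> sA cA iA.
have [Om [zOm lOm]] := annihilator_localizing iA.
have Om0 w : w \in Om -> in_Cstar (lsubmx w).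
  move=> wO i; rewrite mxE; apply/eqP => wi.
  (* Opposite translations cancel, so the product of the two variables minus 1 sends every [f] into
     the annihilator, hence vanishes at [w]. *)
  have /(zOm w wO) : forall f, annihilator A
      (('X_(lshift d i) * 'X_(rshift d i) - 1) *: f).
    move=> f u Au; rewrite scalerBl scale1r lpairB -mpolyXD lpairX.
    rewrite lexpD lexpUl lexpUr subrr.
    by under [X in lpair _ X]eq_fun => k do rewrite add0r; rewrite subrr.
  rewrite mevalB mevalM !mevalXU meval1 wi mul0r sub0r => /eqP.
  by rewrite oppr_eq0 oner_eq0.
exists [seq lsubmx w | w <- Om]; split=> [_ /mapP[w wO ->]|u]; first exact: Om0.
split=> [Au|]; last first.
  move=> su; apply: cA => F e /(su F)[v [Sv Fv]]; exists v; split=> //.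
  by apply: lin_span_sub Sv => // x [].
(* A functional [f] killing the pg-sequences but not [u] is outside the annihilator of [A].
   Localization and a functional [g] with [g f = 1] yield a pg-sequence [v] of [A] with
   [lpair f v = 1], a contradiction. *)
apply: contrapT => /(pw_separation (lin_span_subspace _))[f [fS fu]].
have /lOm[w wO [L [sL NL Lf [K LK]]]] : ~ annihilator A f by move=> /(_ u Au).
have [|g [gD gZ gL gf]] := @separating_functional _ _ (@mpolyC (d + d) R[i]) _ L f _ Lf.
  by case: sL => L0 LD LZ; split=> // c x; apply: LZ.
have [||v [Av pv gE]] := @pg_functional _ _ _ A w K g sA cA (Om0 w wO) gD gZ.
- by move=> h /NL/gL.
- by move=> i h; apply: gL.
move: gf; rewrite gE fS => [/esym/eqP|]; first by rewrite oner_eq0.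
apply: sub_lin_span; split=> //; exists (lsubmx w) => //.
exact: map_f.
Qed.
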